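(* Let $K$ be a field of characteristic zero and let $f\in K[[x]]$ be a compositionally invertible formal power series with $f\neq \mathrm{id}$, and write $f_n=D^n(f)(0)$, so that $f(x)=\sum_{n\ge1} f_n\frac{x^n}{n!}$. Then $f$ is involutory (i.e. $f\circ f=\mathrm{id}$) if and only if there is a sequence of constants $a_1,a_2,a_3,\ldots\in K$ such that for every $n\geq 1$ \[ f_n=\begin{cases} -1, & \text{if } n=1;\\ a_{n/2}, & \text{if } n \text{ is even};\\ \frac12\sum_{k=2}^{n-1} f_k\,B_{n,k}(-1,f_2,\ldots,f_{n-k+1}), & \text{if } n\ge 3 \text{ is odd}.\end{cases} \]
   Context: Functions are formal power series over a fixed field $K$ of characteristic zero. A series $f\in K[[x]]$ is (compositionally) invertible iff $f(0)=0$ and $f'(0)\neq0$; the invertible series form a group under composition $\circ$, with identity $\mathrm{id}(x)=x$. $D$ denotes formal differentiation on $K[[x]]$ and $D^n$ its $n$-th iterate, so $D^n(f)(0)$ is the $n$-th Taylor coefficient $n!\,[x^n]f$. $B_{n,k}$ denotes the partial (exponential) Bell polynomial $B_{n,k}(X_1,\ldots,X_{n-k+1})=\sum \frac{n!}{k_1!k_2!\cdots}\prod_{j\ge1}\left(\frac{X_j}{j!}\right)^{k_j}$, the sum over all nonnegative integers $k_1,k_2,\ldots$ with $\sum_j k_j=k$ and $\sum_j jk_j=n$. *)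

(* Defs.v *)
From mathcomp Require Import all_boot all_algebra.

Set Implicit Arguments.
Unset Strict Implicit.
Unset Printing Implicit Defensive.

Import GRing.Theory.
Local Open Scope ring_scope.

(* The series f stands for \sum_n f n * x^n: the values of f are the ordinary
   coefficients [x^n]f.  Equality of series is equality of all coefficients,
   written f =1 g. *)
Definition fps (K : fieldType) := nat -> K.

Section FormalPowerSeries.
Variable K : fieldType.
Implicit Types f g : fps K.

Definition fps_one : fps K := fun n => (n == 0%N)%:R.

Definition fps_id : fps K := fun n => (n == 1%N)%:R.

Definition fps_mul f g : fps K := fun n => \sum_(i < n.+1) f i * g (n - i)%N.

Definition fps_exp g (k : nat) : fps K := iter k (fps_mul g) fps_one.

(* f o g = \sum_k f k * g^k.  Only meaningful when g 0 = 0; then g^k has no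
   term of degree n for k > n, so truncating at k = n is exact. *)
Definition fps_comp f g : fps K :=
  fun n => \sum_(k < n.+1) f k * fps_exp g k n.

Definition fps_deriv f : fps K := fun n => f n.+1 *+ n.+1.

Definition fps_invertible f : Prop := f 0%N = 0 /\ fps_deriv f 0%N <> 0.

Definition fps_involutory f : Prop := fps_comp f f =1 fps_id.

Definition taylor_coef f (n : nat) : K := iter n fps_deriv f 0%N.

(* Value of the partial Bell polynomial B_{n,k} at X_j = X j for j >= 1 (X 0
   is never read).  The entry m i is the exponent k_{i+1}.  The constraint
   \sum_j j * k_j = n forces k_j <= n for all j >= 1, and k_j = 0 for j > n,
   so that m ranges over all the admissible families.  Together with
   \sum_j k_j = k it also forces k_j = 0 for j > n - k + 1. *)
Definition bell (n k : nat) (X : nat -> K) : K :=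
  \sum_(m : {ffun 'I_n -> 'I_n.+1} |
          (\sum_(i < n) m i == k)%N && (\sum_(i < n) i.+1 * m i == n)%N)
    (n`!%:R / \prod_(i < n) (m i)`!%:R) *
    \prod_(i < n) (X i.+1 / (i.+1)`!%:R) ^+ m i.

End FormalPowerSeries.

(* Main.v *)
(* Write f_n for the Taylor coefficients of f.  By Faa di Bruno, the n-th Taylor
   coefficient of f o f is (f_1 + f_1^n) f_n + S_n with
   S_n = \sum_(2 <= k < n) f_k B_{n,k}(f_1, f_2, ...).  If f o f = id then
   f_1 = 1 or f_1 = -1; the first choice forces f = id, and with f_1 = -1 the
   vanishing of the coefficient at odd n is the recurrence f_n = S_n / 2.
   Conversely, suppose f_1 = -1 and the recurrence holds.  At even n the
   coefficient of f o f is S_n, which vanishes as soon as all lower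
   coefficients agree with those of id, because f commutes with f o f.
   Coefficients of order at most N only depend on the truncation of f at order
   N, so compositions are computed with polynomials. *)
Require Import Defs.
From mathcomp Require Import all_boot all_algebra.
From mathcomp Require Import ring.

Import GRing.Theory.
Local Open Scope ring_scope.

Lemma pchar0_natf_neq0 {K : fieldType} (n : nat) :
  [pchar K] =i pred0 -> (n.+1%:R : K) != 0.
Proof. by move=> /pcharf0P->. Qed.

Lemma pchar0_factf_neq0 {K : fieldType} (n : nat) :
  [pchar K] =i pred0 -> (n`!%:R : K) != 0.
Proof. by move=> charK0; rewrite -(prednK (fact_gt0 n)) pchar0_natf_neq0. Qed.

Lemma iter_fps_deriv {K : fieldType} (f : fps K) (n m : nat) :
  iter n (@fps_deriv K) f m = f (n + m)%N *+ (n + m) ^_ n.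
Proof.
elim: n m => [|n IHn] m; first by rewrite ffactn0.
by rewrite /= /fps_deriv IHn addnS -mulrnA addSn ffactnSr -addnS addKn.
Qed.

Lemma taylor_coefE {K : fieldType} (f : fps K) (n : nat) :
  taylor_coef f n = f n * n`!%:R.
Proof. by rewrite /taylor_coef iter_fps_deriv addn0 ffactnn mulr_natr. Qed.

Definition fps_trunc {K : fieldType} (N : nat) (f : fps K) : {poly K} :=
  \poly_(i < N.+1) f i.

Lemma coef_fps_trunc {K : fieldType} (N : nat) (f : fps K) (n : nat) :
  (n <= N)%N -> (fps_trunc N f)`_n = f n.
Proof. by move=> le_nN; rewrite coef_poly ltnS le_nN. Qed.

Lemma coef_exp_fps_trunc {K : fieldType} (N : nat) (f : fps K) (k n : nat) :
  (n <= N)%N -> (fps_trunc N f ^+ k)`_n = fps_exp f k n.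
Proof.
elim: k n => [|k IHk] n le_nN; first by rewrite expr0 coef1.
rewrite exprS coefM; apply: eq_bigr => i _.
rewrite coef_fps_trunc ?(leq_trans (leq_ord i)) // IHk //.
exact: leq_trans (leq_subr _ _) le_nN.
Qed.

Lemma poly_coef0_eq0 {R : comNzRingType} (p : {poly R}) :
  p`_0 = 0 -> exists r : {poly R}, p = r * 'X.
Proof.
move=> p0; have /factor_theorem[r ->] : root p 0 by rewrite rootE horner_coef0 p0.
by exists r; rewrite subr0.
Qed.

Lemma coef_exp_lt {R : comNzRingType} (p : {poly R}) (k n : nat) :
  p`_0 = 0 -> (n < k)%N -> (p ^+ k)`_n = 0.
Proof.
by move=> /poly_coef0_eq0[r ->] lt_nk; rewrite exprMn coefMXn lt_nk.
Qed.

Lemma coef_exp_diag {R : comNzRingType} (p : {poly R}) (n : nat) :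
  p`_0 = 0 -> (p ^+ n)`_n = p`_1 ^+ n.
Proof.
move=> /poly_coef0_eq0[r ->]; rewrite exprMn coefMXn ltnn subnn coefMX /=.
by rewrite -!horner_coef0 horner_exp.
Qed.

Lemma coef_comp_poly_small {R : comNzRingType} (p q : {poly R}) (n : nat) :
  q`_0 = 0 -> (p \Po q)`_n = \sum_(k < n.+1) p`_k * (q ^+ k)`_n.
Proof.
move=> q0; rewrite coef_comp_poly; set F := fun k : nat => p`_k * (q ^+ k)`_n.
(* Both sums extend to a common range: past [size p] the coefficient of [p] vanishes, past [n] that
   of [q ^+ k]. *)
rewrite (big_ord_widen (maxn (size p) n.+1) F) ?leq_maxl //.
rewrite (big_ord_widen (maxn (size p) n.+1) F) ?leq_maxr //.
rewrite big_mkcond [RHS]big_mkcond; apply: eq_bigr => k _; rewrite /F.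
have [lt_kp|le_pk] := ltnP; have [lt_kn|lt_nk] := ltnP k n.+1 => //.
  by rewrite coef_exp_lt // mulr0.
by rewrite nth_default // mul0r.
Qed.

Lemma fps_comp_trunc {K : fieldType} (N : nat) (f : fps K) (n : nat) :
  f 0%N = 0 -> (n <= N)%N ->
  fps_comp f f n = (fps_trunc N f \Po fps_trunc N f)`_n.
Proof.
move=> f0 le_nN; rewrite coef_comp_poly_small ?coef_fps_trunc //.
apply: eq_bigr => k _; rewrite coef_exp_fps_trunc // coef_fps_trunc //.
exact: leq_trans (leq_ord k) le_nN.
Qed.

(** Truncation at order [N] of exp(aT), where T is the indeterminate of [{poly A}]. *)
Definition exp_trunc {K : fieldType} {A : comAlgType K} (N : nat) (a : A) : {poly A} :=
  \poly_(j < N.+1) (j`!%:R^-1 *: a ^+ j).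

Lemma exp_truncD {K : fieldType} {A : comAlgType K} (N : nat) (a b : A) (k : nat) :
    [pchar K] =i pred0 -> (k <= N)%N ->
  (exp_trunc N a * exp_trunc N b)`_k = k`!%:R^-1 *: (a + b) ^+ k.
Proof.
move=> charK0 le_kN; rewrite addrC exprDn scaler_sumr coefM.
apply: eq_bigr => i _.
have le_iN: (i <= N)%N by apply: leq_trans le_kN; apply: leq_ord.
have le_kiN: (k - i <= N)%N by apply: leq_trans le_kN; apply: leq_subr.
rewrite !coef_poly !ltnS le_iN le_kiN -scalerAl -scalerAr scalerA [in RHS]mulrC.
rewrite -scaler_nat scalerA; congr (_ *: _).
rewrite -(bin_fact (leq_ord i)) !natrM.
have := pchar0_factf_neq0 i charK0; have := pchar0_factf_neq0 (k - i) charK0.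
have : 'C(k, i)%:R != 0 :> K.
  by have := bin_gt0 k i; rewrite leq_ord => /prednK <-; apply: pchar0_natf_neq0.
by move=> *; field; apply/and3P.
Qed.

Lemma coefM_eq {A : comNzRingType} (p p' q : {poly A}) (N n : nat) :
    (forall i, (i <= N)%N -> p`_i = p'`_i) -> (n <= N)%N ->
  (q * p)`_n = (q * p')`_n.
Proof.
move=> pp' le_nN; rewrite !coefM; apply: eq_bigr => i _.
by rewrite pp' // (leq_trans (leq_subr _ _)).
Qed.

(** The exponential turns sums into products; truncation only spoils coefficients beyond [N], so the
    induction compares coefficients up to [N]. *)
Lemma coef_prod_exp_trunc {K : fieldType} {A : comAlgType K} (N : nat)
    {I : Type} (r : seq I) (a : I -> A) (k : nat) :
    [pchar K] =i pred0 -> (k <= N)%N ->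
  (\prod_(i <- r) exp_trunc N (a i))`_k = k`!%:R^-1 *: (\sum_(i <- r) a i) ^+ k.
Proof.
move=> charK0; elim: r k => [|i r IHr] k le_kN.
  rewrite !big_nil coef1 expr0n; case: k {le_kN} => [|k] /=.
    by rewrite invr1 scale1r.
  by rewrite scaler0.
rewrite !big_cons -(exp_truncD _ _ _ _ charK0 le_kN).
apply: (coefM_eq _ _ _ N) => // j le_jN.
by rewrite IHr // coef_poly ltnS le_jN.
Qed.

(** With c_i = X_i / i!, the power (sum of c_i x^i)^k / k! is the coefficient of T^k in the product
    of the exp(c_i x^i T). Truncating each factor at order [n] and distributing the product yields a
    sum over the same maps [m] as in [bell]. *)
Lemma bell_coef_exp {K : fieldType} (n k : nat) (X : nat -> K) :
    [pchar K] =i pred0 -> (k <= n)%N ->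
  bell n k X = n`!%:R / k`!%:R *
    ((\sum_(i < n) (X i.+1 / (i.+1)`!%:R) *: 'X^(i.+1)) ^+ k)`_n.
Proof.
move=> charK0 le_kn; rewrite -mulrA -coefZ.
rewrite -(coef_prod_exp_trunc _ _ _ _ charK0 le_kn).
under eq_bigr do rewrite /exp_trunc poly_def.
rewrite bigA_distr_bigA /= !coef_sum mulr_sumr /bell [LHS]big_mkcond.
apply: eq_bigr => m _; set c := fun i : nat => X i.+1 / (i.+1)`!%:R.
(* The exponents of the inner and outer indeterminates are the two sums constrained in [bell]. *)
have -> : \prod_(i < n) (((m i)`!%:R^-1 *: ((c i) *: 'X^(i.+1)) ^+ m i) *: 'X^(m i)
             : {poly {poly K}}) =
    ((\prod_(i < n) ((m i)`!%:R^-1 * c i ^+ m i)) *: 'X^(\sum_(i < n) i.+1 * m i))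
       *: 'X^(\sum_(i < n) m i).
  rewrite scaler_prod -!prodrXr; congr (_ *: _).
  rewrite -scaler_prod; apply: eq_bigr => i _.
  by rewrite exprZn -exprM scalerA.
rewrite coefZ coefXn eq_sym; have [_|] := eqVneq; last by rewrite mulr0 coef0 mulr0.
rewrite mulr1 coefZ coefXn eq_sym; have [_|] := eqVneq; last by rewrite mulr0 mulr0.
by rewrite mulr1 /= big_split /= prodfV mulrA.
Qed.

Lemma bell_fps_exp {K : fieldType} (f : fps K) (X : nat -> K) (n k : nat) :
    [pchar K] =i pred0 -> f 0%N = 0 -> (k <= n)%N ->
    (forall j, (0 < j)%N -> X j = taylor_coef f j) ->
  bell n k X = n`!%:R / k`!%:R * fps_exp f k n.
Proof.
move=> charK0 f0 le_kn XE; rewrite bell_coef_exp // -(coef_exp_fps_trunc n) //.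
congr (_ * (polyseq (_ ^+ k))`_n); rewrite /fps_trunc poly_def big_ord_recl f0 scale0r add0r.
apply: eq_bigr => i _; rewrite XE // taylor_coefE mulfK //.
exact: pchar0_factf_neq0.
Qed.

(** The terms k = 1 and k = n, equal to f_1 f_n and f_n f_1^n, are split off. *)
Lemma fps_comp_self {K : fieldType} (f : fps K) (n : nat) :
    f 0%N = 0 -> (2 <= n)%N ->
  fps_comp f f n =
    (f 1%N + f 1%N ^+ n) * f n + \sum_(2 <= k < n) f k * fps_exp f k n.
Proof.
move=> f0 le2n; have f0P : (fps_trunc n f)`_0 = 0 by rewrite coef_fps_trunc.
rewrite /fps_comp -(big_mkord xpredT (fun k => f k * fps_exp f k n)).
rewrite big_ltn // f0 mul0r add0r big_ltn ?ltnS ?(ltnW le2n) //.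
rewrite big_nat_recr // -!(coef_exp_fps_trunc n) // expr1 coef_exp_diag //.
rewrite !coef_fps_trunc ?(ltnW le2n) // mulrDl [f n * _]mulrC -addrA.
by congr (_ + _); rewrite addrC; congr (_ + _); apply: eq_big_nat => k _;
  rewrite coef_exp_fps_trunc.
Qed.

(** For f_1 = -1 the factor f_1 + f_1^n is -2 at odd n and 0 at even n. *)
Lemma taylor_coef_fps_comp_self {K : fieldType} (f : fps K) (X : nat -> K) (n : nat) :
    [pchar K] =i pred0 -> f 0%N = 0 -> f 1%N = -1 ->
    (forall j, (0 < j)%N -> X j = taylor_coef f j) -> (2 <= n)%N ->
  taylor_coef (fps_comp f f) n =
    \sum_(2 <= k < n) taylor_coef f k * bell n k X
      - (if odd n then taylor_coef f n *+ 2 else 0).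
Proof.
move=> charK0 f0 f1 XE le2n; rewrite taylor_coefE fps_comp_self // f1 mulrDl addrC.
congr (_ + _).
  rewrite mulr_suml; apply: eq_big_nat => k /andP[_ lt_kn].
  rewrite (bell_fps_exp f) // ?(ltnW lt_kn) // taylor_coefE.
  by have := pchar0_factf_neq0 k charK0 => ?; field.
rewrite taylor_coefE -signr_odd; case: (odd n) => /=; ring.
Qed.

Lemma expr1D_modX {R : comNzRingType} (d : {poly R}) (n k : nat) :
  exists s, (1 + d * 'X^n) ^+ k = 1 + s * 'X^n.
Proof.
elim: k => [|k [s IHk]]; first by exists 0; rewrite mul0r addr0.
exists (d + s + d * s * 'X^n); rewrite exprS IHk; ring.
Qed.

(** Since q = x (1 + d x^n), q^k = x^k (1 + s x^n), and the correction starts in degree n + k > n +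
    1. *)
Lemma coef_exp_near_X {R : comNzRingType} (q : {poly R}) (n k : nat) :
    (forall m, (m < n.+1)%N -> q`_m = (m == 1%N)%:R) -> (2 <= k <= n.+1)%N ->
  (q ^+ k)`_n.+1 = (k == n.+1)%:R.
Proof.
move=> qE /andP[le2k le_kn].
have lt0n : (0 < n)%N by rewrite -ltnS (leq_trans le2k).
have -> : q = (1 + drop_poly n.+1 q * 'X^n) * 'X.
  rewrite -{1}(poly_take_drop n.+1 q) mulrDl mul1r -mulrA -exprSr.
  congr (_ + _); apply/polyP => i; rewrite coef_take_poly coefX.
  have [/qE//|lt_ni] := ltnP i n.+1; rewrite gtn_eqF //.
  exact: leq_trans lt_ni.
rewrite exprMn; have [s ->] := expr1D_modX (drop_poly n.+1 q) n k.
rewrite coefMXn ltnNge le_kn /= coefD coef1 coefMXn.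
have -> : (n.+1 - k < n)%N.
  by rewrite ltn_subLR // (leq_trans _ (leq_add le2k (leqnn n))).
by rewrite addr0 subn_eq0 [in RHS]eqn_leq le_kn.
Qed.

(* If p o p = x + c x^n + ..., comparing the coefficients of x^n in
   p o (p o p) = (p o p) o p gives p_1 c = c p_1 ^ n, that is -c = c. *)
Lemma coef_comp_self_even {K : fieldType} (p : {poly K}) (n : nat) :
    [pchar K] =i pred0 -> p`_0 = 0 -> p`_1 = -1 -> ~~ odd n -> (2 <= n)%N ->
    (forall m, (m < n)%N -> (p \Po p)`_m = (m == 1%N)%:R) ->
  (p \Po p)`_n = 0.
Proof.
move=> charK0 p0 p1; case: n => // n even_n le2n.
set q := p \Po p => qE.
have q0 : q`_0 = 0 by rewrite qE.
have q1 : q`_1 = 1 by rewrite qE.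
have split (F : nat -> K) : \sum_(k < n.+2) F k =
    F 0%N + F 1%N + \sum_(2 <= k < n.+1) F k + F n.+1.
  rewrite -(big_mkord xpredT) big_ltn // big_ltn // big_nat_recr //=.
  by rewrite !addrA.
have := congr1 (fun r : {poly K} => r`_n.+1) (comp_polyA p p p).
rewrite -/q (coef_comp_poly_small p) // (coef_comp_poly_small q) //.
rewrite (split (fun k => p`_k * (q ^+ k)`_n.+1)).
rewrite (split (fun k => q`_k * (p ^+ k)`_n.+1)).
rewrite p0 q0 !mul0r !add0r p1 q1 !expr1 !coef_exp_diag // p1 q1.
(* The middle terms vanish on the left by [coef_exp_near_X], on the right because q_k = 0. With c =
   q_(n+1), this leaves p_(n+1) - c = p_(n+1) + c. *)
rewrite big_nat big1 => [|k /andP[le2k lt_kn]]; last first.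
  by rewrite coef_exp_near_X ?le2k ?(ltnW lt_kn) // (ltn_eqF lt_kn) mulr0.
rewrite big_nat big1 => [|k /andP[le2k lt_kn]]; last first.
  by rewrite qE // gtn_eqF // mul0r.
rewrite expr1n -signr_odd (negPf even_n) expr0 !addr0 !mulr1 mulN1r mul1r addrC.
move=> /addrI /eqP; rewrite eq_sym -subr_eq0 opprK -mulr2n -mulr_natr mulf_eq0.
by rewrite (negPf (pchar0_natf_neq0 1 charK0)) orbF => /eqP.
Qed.

(** By strong induction, the middle sum of [fps_comp_self] vanishes and 2 f_n = 0 remains. *)
Lemma fps_involutory_id {K : fieldType} (f : fps K) :
    [pchar K] =i pred0 -> f 0%N = 0 -> f 1%N = 1 -> fps_involutory f ->
  f =1 @fps_id K.
Proof.
move=> charK0 f0 f1 ffE; elim/ltn_ind=> [] [|[|n]] // IHn.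
have := ffE n.+2; rewrite fps_comp_self // f1 expr1n big_nat big1 => [|k /andP[le2k lt_kn]].
  rewrite addr0 /fps_id /= => /eqP.
  by rewrite mulf_eq0 (negPf (pchar0_natf_neq0 1 charK0)) => /eqP.
by rewrite IHn // /fps_id gtn_eqF // mul0r.
Qed.

Theorem theorem2p1 (K : fieldType) (charK0 : [pchar K] =i pred0)
  (f : fps K) (finv : fps_invertible f) (fNid : ~ (f =1 @fps_id K)) :
  fps_involutory f <->
  exists a : nat -> K, forall n : nat, (1 <= n)%N ->
    taylor_coef f n =
      if n == 1%N then -1
      else if ~~ odd n then a n./2
      else 2%:R^-1 *
           \sum_(2 <= k < n)
              taylor_coef f k *
              bell n k (fun j => if j == 1%N then -1 else taylor_coef f j).
Proof.
have [f0 _] := finv; have nz2 : 2%:R != 0 :> K := pchar0_natf_neq0 1 charK0.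
set X : nat -> K := fun j => _.
have ff1 : fps_comp f f 1%N = f 1%N ^+ 2.
  by rewrite (fps_comp_trunc 1) // coef_comp_poly_small ?coef_fps_trunc //
    big_ord_recl big_ord1 /= expr1 !coef_fps_trunc // f0 mul0r add0r.
have XE : f 1%N = -1 -> forall j, (0 < j)%N -> X j = taylor_coef f j.
  by move=> f1 [|[|j]] // _; rewrite taylor_coefE f1 mulr1.
split=> [ffE | [a fE]].
  have f1 : f 1%N = -1.
    have /eqP := ffE 1%N; rewrite ff1 sqrf_eq1 => /orP[/eqP f1|/eqP//].
    by case: fNid; apply: fps_involutory_id.
  (* The constants are read off as a_m = f_(2m). *)
  exists (fun n => taylor_coef f n.*2) => -[|[|n]] // _.
  case: ifPn => [even_n|]; first by rewrite even_halfK.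
  rewrite negbK => odd_n.
  have := taylor_coef_fps_comp_self f X n.+2 charK0 f0 f1 (XE f1) isT.
  rewrite odd_n taylor_coefE ffE mul0r => /esym/subr0_eq ->.
  by rewrite -[taylor_coef _ _ *+ 2]mulr_natl mulKf.
have f1 : f 1%N = -1 by have := fE 1%N isT; rewrite taylor_coefE mulr1.
elim/ltn_ind=> n IHn; case: n IHn => [|[|n]] IHn.
- by rewrite /fps_comp big_ord1 f0 mul0r.
- by rewrite ff1 f1 sqrrN expr1n.
- rewrite /fps_id /=; have [odd_n|even_n] := boolP (odd n.+2); last first.
    rewrite (fps_comp_trunc n.+2) //; apply: coef_comp_self_even;
      rewrite ?coef_fps_trunc // => m lt_mn.
    by rewrite -fps_comp_trunc ?(ltnW lt_mn) // IHn.
  have := taylor_coef_fps_comp_self f X n.+2 charK0 f0 f1 (XE f1) isT.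
  (* The recurrence cancels the sum against 2 f_n, so n! times the coefficient of [fps_comp f f] is
     0. *)
  rewrite odd_n fE // odd_n /= -[_ *+ 2]mulr_natl mulVKf // subrr taylor_coefE => /eqP.
  by rewrite mulf_eq0 (negPf (pchar0_factf_neq0 _ charK0)) orbF => /eqP.
Qed.
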